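(* Let $G$ be a finite group, let $N$ be a normal subgroup of $G$, and let $F$ be a field of characteristic $2$ which is a splitting field for all subgroups of $G$. Then all non-trivial self-dual irreducible $FG$-modules are of quadratic type if and only if both of the following hold: all non-trivial self-dual irreducible $FN$-modules are of quadratic type, and all non-trivial self-dual irreducible $F(G/N)$-modules are of quadratic type.
   Context: Modules are finite-dimensional; a module is self-dual if it is isomorphic to its dual. A non-trivial self-dual irreducible module over $F$ for a finite group is of quadratic type if it affords a non-zero group-invariant quadratic form with values in $F$. *)

(* Defs.v *)
From mathcomp Require Import all_boot all_order all_fingroup all_algebra.
From mathcomp Require Import all_solvable all_field all_character.

Set Implicit Arguments.
Unset Strict Implicit.
Unset Printing Implicit Defensive.

Import GRing.Theory.
Local Open Scope ring_scope.

(* A finite-dimensional FG-module is a matrix representation of G over F,      *)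
(* acting by x on row vectors as v |-> v *m rG x.                              *)

Section Modules.

Variables (F : fieldType) (gT : finGroupType) (G : {group gT}) (n : nat).
Variable rG : mx_representation F G n.

(* The dual basis turns a linear form f on 'rV_n into the row vector w such    *)
(* that f v = (v *m w^T) 0 0; the contragredient action (f x) v = f (v x^-1)   *)
(* then reads w |-> w *m (rG x^-1)^T.                                          *)
Definition dual_mx (x : gT) : 'M[F]_n := (rG x^-1%g)^T.

Lemma dual_mx_repr : mx_repr G dual_mx.
Proof.
split=> [|x y Gx Gy]; first by rewrite /dual_mx invg1 repr_mx1 trmx1.
by rewrite /dual_mx invMg repr_mxM ?groupV // trmx_mul.
Qed.

Definition dual_repr : mx_representation F G n := MxRepresentation dual_mx_repr.

Definition self_dual : Prop := mx_rsim rG dual_repr.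

(* Valid in every characteristic: no division by 2 is involved.                *)
Definition quadratic_form (Q : 'rV[F]_n -> F) : Prop :=
  (forall (a : F) (v : 'rV[F]_n), Q (a *: v) = a ^+ 2 * Q v)
  /\ bilinear_for *%R *%R (fun u v : 'rV[F]_n => Q (u + v) - Q u - Q v).

Definition quadratic_type : Prop :=
  exists Q : 'rV[F]_n -> F,
    [/\ quadratic_form Q,
        exists v, Q v != 0
      & forall x v, x \in G -> Q (v *m rG x) = Q v].

End Modules.

(* An irreducible module is trivial when every element of G acts as the        *)
(* identity, i.e. when its kernel is all of G.                                 *)
Definition all_quadratic_type (F : fieldType) (gT : finGroupType)
    (G : {group gT}) : Prop :=
  forall (n : nat) (rG : mx_representation F G n),
    mx_irreducible rG -> self_dual rG -> ~~ (G \subset rker rG) ->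
    quadratic_type rG.

(* Main.v *)
Require Import Defs.
From mathcomp Require Import all_boot all_order all_fingroup all_algebra.
From mathcomp Require Import all_solvable all_field all_character.
From mathcomp Require Import boolp ring.

(* Let M be a self-dual irreducible FG-module with invariant symmetric form B,  *)
(* and suppose that N acts nontrivially on it. An additive N-invariant map      *)
(* M -> F vanishes since [M, N] = M, so an N-invariant quadratic form with      *)
(* polar form B is unique, hence G-invariant; it exists because M is, over N, a *)
(* sum of simple modules, on each of which B is zero or, by Schur's lemma, a    *)
(* multiple of the polar form of a quadratic form.                              *)
(* Conversely, let L be a self-dual irreducible FN-module with form B. For each *)
(* g in the inertia group T the isometry of B intertwining L with its conjugate *)
(* by g is unique, since -1 = 1; so L extends to T, with B invariant, and the   *)
(* module induced from T to G is irreducible and self-dual. A quadratic form on *)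
(* it restricts to a nonzero one on L. An intertwiner is only a similitude a    *)
(* priori; its multiplier is a square because, F being a splitting field for    *)
(* N<g>, it can be rescaled to have finite order, and a root of unity in        *)
(* characteristic 2 is a square.                                                *)

(** A self-duality is a non-degenerate invariant bilinear form ([self_dual_form]). Over a splitting
    field Schur's lemma makes it unique up to a scalar ([inv_form_uniq]), hence symmetric in
    characteristic 2 ([inv_form_sym]). For a non-trivial irreducible module, quadratic type
    therefore means that this form is the polar form of an invariant quadratic form.

    From right to left, a module on which [N] acts trivially is a module for [G / N]; on any other,
    [polarizable1] lifts the form over [N], and uniqueness of the lift makes it [G]-invariant
    ([normal_quadratic_type]).

    From left to right, [G / N] is handled by inflation, and an [N]-module L is placed inside an
    irreducible self-dual [G]-module by [inertia_extension] and [ind_irr]. The danger is an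
    obstruction to extending L to its inertia group. Requiring the intertwiners to be isometries
    removes all freedom in their choice, so they multiply correctly; that they can be so normalized
    is [scaled_isometry_sqrt], which rests on [cyclic_intertwiner_scalar]. *)

Set Implicit Arguments.
Unset Strict Implicit.
Unset Printing Implicit Defensive.

Import GRing.Theory.
Local Open Scope ring_scope.

(** * Invariant bilinear and quadratic forms *)

Section Forms.

Variables (F : fieldType) (gT : finGroupType).
Implicit Types G N : {group gT}.

Definition bform n (B : 'M[F]_n) (u v : 'rV_n) : F := (u *m B *m v^T) 0 0.

Definition inv_form G n (rG : mx_representation F G n) (B : 'M_n) :=
  {in G, forall x, rG x *m B *m (rG x)^T = B}.

(** The polar identity is required only on the row space of [U], so that forms on submodules can be
    glued without changing the ambient type. *)
Definition polar_on n (U B : 'M[F]_n) (Q : 'rV[F]_n -> F) :=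
  (forall a v, Q (a *: v) = a ^+ 2 * Q v) /\
  (forall u v, (u <= U)%MS -> (v <= U)%MS -> Q (u + v) = Q u + Q v + bform B u v).

Lemma bformDl n (B : 'M_n) u v w : bform B (u + v) w = bform B u w + bform B v w.
Proof. by rewrite /bform !mulmxDl mxE. Qed.

Lemma bformDr n (B : 'M_n) u v w : bform B u (v + w) = bform B u v + bform B u w.
Proof. by rewrite /bform linearD mulmxDr mxE. Qed.

Lemma bformZl n (B : 'M_n) a u v : bform B (a *: u) v = a * bform B u v.
Proof. by rewrite /bform -!scalemxAl mxE. Qed.

Lemma bformZr n (B : 'M_n) a u v : bform B u (a *: v) = a * bform B u v.
Proof. by rewrite /bform linearZ -scalemxAr mxE. Qed.

Lemma bformC n (B : 'M_n) u v : B^T = B -> bform B u v = bform B v u.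
Proof.
move=> symB; rewrite /bform.
have -> : u *m B *m v^T = (v *m B *m u^T)^T.
  by rewrite !trmx_mul trmxK symB mulmxA.
by rewrite mxE.
Qed.

Lemma bform_inj n (B C : 'M_n) : bform B =2 bform C -> B = C.
Proof.
move=> eqBC; apply/matrixP=> i j.
have bE (D : 'M_n) : D i j = bform D (delta_mx 0 i) (delta_mx 0 j).
  by rewrite /bform -rowE trmx_delta -colE !mxE.
by rewrite !bE eqBC.
Qed.

Lemma bform_mul n m (B : 'M_n) (u v : 'rV_m) (X Y : 'M_(m, n)) :
  bform B (u *m X) (v *m Y) = bform (X *m B *m Y^T) u v.
Proof. by rewrite /bform trmx_mul !mulmxA. Qed.

Lemma inv_formE G n (rG : mx_representation F G n) B x u v :
  inv_form rG B -> x \in G -> bform B (u *m rG x) (v *m rG x) = bform B u v.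
Proof. by move=> invB Gx; rewrite bform_mul invB. Qed.

Lemma quadratic_form_polar n (Q : 'rV[F]_n -> F) :
  quadratic_form Q -> exists B, polar_on 1%:M B Q.
Proof.
case=> QZ [bil_l bil_r].
pose b u v := Q (u + v) - Q u - Q v.
have bDl a u u' v : b (a *: u + u') v = a * b u v + b u' v by exact: bil_l.
have bDr a u v v' : b u (a *: v + v') = a * b u v + b u v' by exact: bil_r.
have b0l v : b 0 v = 0.
  apply: (@addrI _ (b 0 v)).
  by rewrite addr0 -{1}(mul1r (b 0 v)) -bDl scaler0 add0r.
have b0r u : b u 0 = 0.
  apply: (@addrI _ (b u 0)).
  by rewrite addr0 -{1}(mul1r (b u 0)) -bDr scaler0 add0r.
pose B := \matrix_(i, j) b (delta_mx 0 i) (delta_mx 0 j).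
have bE u v : b u v = bform B u v.
  have -> : b u v = \sum_j u 0 j * b (delta_mx 0 j) v.
    rewrite {1}[u]row_sum_delta.
    by apply: (big_rec2 (fun x y => b x v = y)) => [|j y x _ <-]; rewrite ?b0l.
  have bvE j : b (delta_mx 0 j) v = \sum_i v 0 i * B j i.
    rewrite {1}[v]row_sum_delta.
    apply: (big_rec2 (fun x y => b _ x = y)) => [|i y x _ <-] //.
    by rewrite bDr mxE.
  rewrite /bform -mulmxA mxE; apply: eq_bigr => j _; congr (_ * _).
  by rewrite bvE [RHS]mxE; apply: eq_bigr => i _; rewrite mulrC [v^T i 0]mxE.
exists B; split=> // u v _ _.
by rewrite -bE [RHS]addrC /b -[Q _ - _ - _]addrA -opprD subrK.
Qed.

Lemma polar_neq0 n (B : 'M_n) (Q : 'rV[F]_n -> F) :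
  polar_on 1%:M B Q -> B != 0 -> exists v, Q v != 0.
Proof.
case=> _ QD nzB; apply: contrapT => Q0; case/eqP: nzB; apply: bform_inj => u v.
have {}Q0 w : Q w = 0 by apply: contrapT => /eqP nzQ; apply: Q0; exists w.
have := QD u v; rewrite !submx1 !Q0 !add0r => <- //.
by rewrite /bform mulmx0 mul0mx mxE.
Qed.

Lemma polar_quadratic_form n (B : 'M_n) (Q : 'rV[F]_n -> F) :
  polar_on 1%:M B Q -> quadratic_form Q.
Proof.
case=> QZ QD; split=> //.
have bE u v : Q (u + v) - Q u - Q v = bform B u v.
  by rewrite QD ?submx1 // [X in X - _ - _]addrC [Q u + _]addrC !addrA !addrK.
split=> [v a u w | u a v w]; rewrite !bE.
  by rewrite bformDl bformZl.
by rewrite bformDr bformZr.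
Qed.

(** Multiplying the intertwining relation with the dual on the right by [(rG x)^T] turns it into
    invariance of the form. *)
Lemma self_dual_form G n (rG : mx_representation F G n) :
  self_dual rG <-> exists2 B, B \in unitmx & inv_form rG B.
Proof.
split=> [[B _ freeB invB] | [B unitB invB]].
  exists B => [|x Gx]; first by rewrite -row_free_unit.
  rewrite invB //= /dual_mx -mulmxA -trmx_mul -repr_mxM ?groupV //.
  by rewrite mulgV repr_mx1 trmx1 mulmx1.
exists B; rewrite ?row_free_unit // => x Gx /=.
rewrite -{2}(invB x Gx) /dual_mx -!mulmxA -trmx_mul -repr_mxM ?groupV //.
by rewrite mulVg repr_mx1 trmx1 mulmx1.
Qed.

Lemma inv_form_tr G n (rG : mx_representation F G n) B x :
  inv_form rG B -> x \in G -> rG x *m B = B *m (rG x^-1%g)^T.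
Proof.
move=> invB Gx; rewrite -{2}(invB x Gx) -!mulmxA -trmx_mul -repr_mxM ?groupV //.
by rewrite mulVg repr_mx1 trmx1 mulmx1.
Qed.

Lemma unitmx_neq0 n (B : 'M[F]_n) : (0 < n)%N -> B \in unitmx -> B != 0.
Proof.
move=> n_gt0; apply: contraTneq => ->.
by rewrite -row_free_unit /row_free mxrank0 eq_sym -lt0n.
Qed.

(** The radical of an invariant form is a submodule. *)
Lemma inv_form_unit G n (rG : mx_representation F G n) B :
  mx_irreducible rG -> inv_form rG B -> B != 0 -> B \in unitmx.
Proof.
case/mx_irrP=> _ irrG invB nzB.
rewrite -row_free_unit -kermx_eq0; apply: contraNT nzB => nzK.
have /irrG/(_ nzK) : mxmodule rG (kermx B).
  apply/mxmoduleP=> x Gx; apply/sub_kermxP.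
  by rewrite -mulmxA (inv_form_tr invB) // mulmxA mulmx_ker mul0mx.
by rewrite -sub1mx => /sub_kermxP; rewrite mul1mx => ->.
Qed.

Lemma inv_form_uniq G n (rG : mx_representation F G n) B P :
  mx_absolutely_irreducible rG -> inv_form rG B -> B \in unitmx ->
  inv_form rG P -> exists c, P = c *: B.
Proof.
move=> absG invB unitB invP.
have /(mx_abs_irr_cent_scalar absG)/is_scalar_mxP[c Dc] : centgmx rG (P *m invmx B).
  apply/centgmxP=> x Gx; rewrite [RHS]mulmxA (inv_form_tr invP) // -!mulmxA.
  congr (_ *m _); apply: (can_inj (mulKmx unitB)).
  by rewrite mulKVmx // mulmxA -(inv_form_tr invB) // mulmxK.
by exists c; rewrite -mul_scalar_mx -Dc mulmxKV.
Qed.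

End Forms.

(** * Extending quadratic forms from a normal subgroup *)

(* The commutator module [M, N] spanned by the images of the rG x - 1 is a       *)
(* nonzero G-submodule of M, hence all of M.                                   *)
Lemma inv_additive_eq0 (F : fieldType) (gT : finGroupType) (G N : {group gT}) n
    (rG : mx_representation F G n) (phi : 'rV[F]_n -> F) :
    (N <| G)%g -> mx_irreducible rG -> ~~ (N \subset rker rG) ->
    (forall u v, phi (u + v) = phi u + phi v) ->
    (forall x v, x \in N -> phi (v *m rG x) = phi v) ->
  forall v, phi v = 0.
Proof.
move=> nsNG /mx_irrP[_ irrG] ntN phiD phiN v.
have [sNG nNG] := andP nsNG.
pose W := (\sum_(x in N) (rG x - 1%:M))%MS.
have modW : mxmodule rG W.
  apply/mxmoduleP=> g Gg; rewrite sumsmxMr; apply/sumsmx_subP=> x Nx.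
  have Gx := subsetP sNG x Nx.
  have -> : (rG x - 1%:M) *m rG g = rG g *m (rG (x ^ g)%g - 1%:M).
    rewrite mulmxBl mulmxBr mul1mx mulmx1 -!repr_mxM ?groupJ //.
    by rewrite -conjgC.
  apply: submx_trans (submxMl _ _) _.
  by rewrite (sumsmx_sup (x ^ g)%g) // memJ_norm // (subsetP nNG).
have nzW : W != 0.
  apply: contraNneq ntN => W0; apply/subsetP=> x Nx; apply/rkerP.
  split; first exact: (subsetP sNG).
  apply/eqP; rewrite -subr_eq0 -submx0 -W0.
  by rewrite (sumsmx_sup x).
have: (v <= W)%MS by rewrite submx_full // irrG.
case/sub_sumsmxP=> w ->.
have phi0 : phi 0 = 0 by apply: (@addrI _ (phi 0)); rewrite -phiD !addr0.
apply: (big_ind (fun v => phi v = 0)) => // [x y phix phiy | x Nx].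
  by rewrite phiD phix phiy addr0.
apply: (@addIr _ (phi (w x))); rewrite -phiD add0r mulmxBr mulmx1 subrK.
exact: phiN.
Qed.

Lemma inv_polar (F : fieldType) (gT : finGroupType) (G : {group gT}) n
    (rG : mx_representation F G n) (B : 'M_n) Q :
  polar_on 1%:M B Q -> (forall x v, x \in G -> Q (v *m rG x) = Q v) ->
  inv_form rG B.
Proof.
case=> _ QD Qinv x Gx; apply: bform_inj => u v; rewrite -bform_mul.
apply: (@addrI _ (Q u + Q v)); rewrite -[RHS]QD ?submx1 //.
by rewrite -(Qinv x u) // -(Qinv x v) // -QD ?submx1 // -mulmxDl Qinv.
Qed.

(** If the polar form were zero, [Q] would be additive and [G]-invariant, hence zero by
    [inv_additive_eq0] with [G] as its own normal subgroup. *)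
Lemma quadratic_form_unit_polar (F : fieldType) (gT : finGroupType)
    (G : {group gT}) n (rG : mx_representation F G n) :
    mx_irreducible rG -> ~~ (G \subset rker rG) -> quadratic_type rG ->
  exists B Q, [/\ B \in unitmx, inv_form rG B, polar_on 1%:M B Q
                & forall x v, x \in G -> Q (v *m rG x) = Q v].
Proof.
move=> irrG ntG [Q [quadQ [v nzQ] Qinv]].
have [B polQ] := quadratic_form_polar quadQ; have [QZ QD] := polQ.
have invB := inv_polar polQ Qinv.
exists B, Q; split=> //; apply: (inv_form_unit irrG) => //.
apply: contraNneq nzQ => B0; apply/eqP.
apply: (inv_additive_eq0 (normal_refl G) irrG ntG) => // u w.
by rewrite QD ?submx1 // B0 /bform mulmx0 mul0mx mxE addr0.
Qed.

(** A non-zero [B] makes the module self-dual, so it has an invariant quadratic form; by Schur's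
    lemma [B] is a multiple of its polar form, and the quadratic form is rescaled accordingly. *)
Lemma irr_form_polar (F : fieldType) (gT : finGroupType) (N : {group gT}) n
    (rN : mx_representation F N n) (B : 'M_n) :
    all_quadratic_type F N -> group_splitting_field F N -> mx_irreducible rN ->
    ~~ (N \subset rker rN) -> inv_form rN B ->
  exists2 Q, polar_on 1%:M B Q & forall x v, x \in N -> Q (v *m rN x) = Q v.
Proof.
move=> quadN splitN irrN ntN invB; have [B0 | nzB] := eqVneq B 0.
  exists (fun=> 0) => //; split=> [a _ | u v _ _]; first by rewrite mulr0.
  by rewrite B0 /bform mulmx0 mul0mx mxE !addr0.
have unitB := inv_form_unit irrN invB nzB.
have sdN : self_dual rN by apply/self_dual_form; exists B.
have [C [Q [unitC invC [QZ QD] Qinv]]] :=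
  quadratic_form_unit_polar irrN ntN (quadN _ _ irrN sdN ntN).
have [c ->] := inv_form_uniq (splitN _ _ irrN) invC unitC invB.
exists (fun v => c * Q v) => [|x v Nx]; last by rewrite Qinv.
split=> [a v | u v _ _]; first by rewrite QZ mulrCA.
by rewrite QD ?submx1 // !mulrDr /bform -scalemxAr -scalemxAl !mxE.
Qed.

Section Extend.

Variables (F : fieldType) (gT : finGroupType) (G N : {group gT}) (n : nat).
Variables (rG : mx_representation F G n) (nsNG : (N <| G)%g) (B : 'M[F]_n).

Hypotheses (irrG : mx_irreducible rG) (ntN : ~~ (N \subset rker rG)).
Hypotheses (invB : inv_form rG B) (symB : B^T = B).
Hypotheses (quadN : all_quadratic_type F N).
Hypothesis (splitN : group_splitting_field F N).

Let rN := subg_repr rG (normal_sub nsNG).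

Definition polarizable (W : 'M[F]_n) := mxmodule rN W /\
  exists2 Q, polar_on W B Q
    & forall x v, x \in N -> (v <= W)%MS -> Q (v *m rG x) = Q v.

(** In a basis [V] of [U] the form becomes [V *m B *m V^T], to which [irr_form_polar] applies. [N]
    is non-trivial on [U]: its fixed space is a [G]-submodule because [N] is normal, so if it
    contained [U] it would be everything. *)
Lemma simple_polarizable U : mxsimple rN U -> polarizable U.
Proof.
move=> simU; have [modU nzU _] := simU; split=> //.
have irrU := (submod_mx_irr modU).2 simU.
pose V : 'M[F]_(\rank U, n) := @val_submod _ _ U _ 1%:M.
have rV x : x \in N -> submod_repr modU x *m V = V *m rG x.
  move=> Nx; rewrite /V -val_submodE -[submod_repr _ _]mul1mx val_submodJ //.
have inV (v : 'rV_n) : (v <= U)%MS -> in_submod U v *m V = v.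
  by move=> sV; rewrite -val_submodE in_submodK.
clearbody V; have invBU : inv_form (submod_repr modU) (V *m B *m V^T).
  move=> x Nx.
  have mulV (X : 'M_(\rank U)) :
      X *m (V *m B *m V^T) *m X^T = X *m V *m B *m (X *m V)^T.
    by rewrite trmx_mul !mulmxA.
  rewrite mulV rV // trmx_mul !mulmxA.
  congr (_ *m _); rewrite -!mulmxA; congr (_ *m _); rewrite mulmxA.
  by rewrite invB ?(subsetP (normal_sub nsNG)).
have ntU : ~~ (N \subset rker (submod_repr modU)).
  rewrite rker_submod /= rstab_subg subsetI subxx /=.
  apply: contra ntN => fixU.
  have {fixU} sUfix : (U <= rfix_mx rG N)%MS.
    apply/rfix_mxP=> x Nx.
    by move/subsetP/(_ x Nx): fixU; rewrite inE => /andP[_ /eqP].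
  have: row_full (rfix_mx rG N).
    have [_ irr] := (mx_irrP rG).1 irrG; apply: irr.
      exact: normal_rfix_mx_module.
    by apply: contraNneq nzU => fix0; rewrite -submx0 -fix0.
  rewrite -sub1mx => /rfix_mxP fix1; apply/subsetP=> x Nx; apply/rkerP.
  split; first exact: (subsetP (normal_sub nsNG)).
  by rewrite -[rG x]mul1mx fix1.
have [Q [QZ QD] Qinv] := irr_form_polar quadN splitN irrU ntU invBU.
exists (fun v => Q (in_submod U v)); first split.
- by move=> a v; rewrite linearZ QZ.
- move=> u v sU sV; rewrite linearD QD ?submx1 // -bform_mul.
  by rewrite !inV.
move=> x v Nx sV; rewrite -[rG x]/(rN x) (in_submodJ modU) //.
exact: Qinv.
Qed.

(** A simple [U] either lies in [W] or meets it in 0. In the direct case the two forms are added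
    along the projections [p] and [q], with the cross term [bform B (v *m p) (v *m q)] accounting
    for the values of [B] between the summands; symmetry of [B] identifies its two mixed terms. *)
Lemma polarizableD U W :
  mxsimple rN U -> polarizable W -> polarizable (U + W)%MS.
Proof.
move=> simU polW; have [modU [Q1 [Q1Z Q1D] Q1inv]] := simple_polarizable simU.
have [modW [Q2 [Q2Z Q2D] Q2inv]] := polW.
split; first exact: addsmx_module.
have [capUW0 | nzUW] := eqVneq (U :&: W)%MS 0; last first.
  have sUW : (U <= W)%MS.
    have [_ _ minU] := simU; apply: submx_trans (capmxSr U W).
    by apply: minU nzUW; rewrite ?capmxSl ?capmx_module.
  exists Q2 => [|x v Nx].
    by split=> // u v; rewrite !(addsmx_idPr sUW); apply: Q2D.
  by rewrite (addsmx_idPr sUW); apply: Q2inv.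
have capWU0 : (W :&: U)%MS = 0 by apply/eqP; rewrite capmxC capUW0.
pose p := proj_mx U W; pose q := proj_mx W U.
have pU (v : 'rV_n) : (v *m p <= U)%MS by apply: proj_mx_sub.
have qW (v : 'rV_n) : (v *m q <= W)%MS by apply: proj_mx_sub.
have pq (v : 'rV_n) : (v <= U + W)%MS -> v *m p + v *m q = v by apply: add_proj_mx.
have sN x : x \in N -> x \in G by apply: (subsetP (normal_sub nsNG)).
have pN x (v : 'rV_n) : x \in N -> (v <= U + W)%MS -> v *m rG x *m p = v *m p *m rG x.
  move=> Nx sV.
  suffices /hom_mxP/(_ x Nx) : (v <= dom_hom_mx rN p)%MS by [].
  by apply: submx_trans sV (proj_mx_hom _ _ _).
have qN x (v : 'rV_n) : x \in N -> (v <= U + W)%MS -> v *m rG x *m q = v *m q *m rG x.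
  move=> Nx; rewrite addsmxC => sV.
  suffices /hom_mxP/(_ x Nx) : (v <= dom_hom_mx rN q)%MS by [].
  by apply: submx_trans sV (proj_mx_hom _ _ _).
exists (fun v => Q1 (v *m p) + Q2 (v *m q) + bform B (v *m p) (v *m q)).
  split=> [a v | u v sU sV].
    rewrite -!scalemxAl Q1Z Q2Z bformZl bformZr; ring.
  have -> : bform B u v = bform B (u *m p + u *m q) (v *m p + v *m q).
    by rewrite !pq.
  rewrite !mulmxDl Q1D // Q2D //.
  rewrite !(bformDl, bformDr) (bformC (v *m p) (u *m q) symB); ring.
move=> x v Nx sV; rewrite pN // qN // Q1inv // Q2inv //.
by rewrite (inv_formE _ _ invB) ?sN.
Qed.

(** By Clifford's theorem the whole module is a sum of [G]-translates of one simple [N]-submodule;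
    these are added one at a time. *)
Lemma polarizable1 : polarizable 1%:M.
Proof.
(* [mxsimple_exists] gives its witness only classically, that is, towards a boolean goal. *)
apply/asboolP.
have [modN nz1] : mxmodule rN 1%:M /\ (1%:M : 'M[F]_n) != 0.
  by case: irrG => modG nz1 _; split=> //; apply: mxmodule1.
apply: (mxsimple_exists modN nz1) => -[M simM _]; apply/asboolP.
have [X sXG [defS _]] := Clifford_basis irrG simM.
have: polarizable (\sum_(x in X) M *m rG x)%MS.
  apply: big_rec => [|x W Xx polW].
    split; first exact: mxmodule0.
    exists (fun=> 0) => //; split=> [a v | u v]; first by rewrite mulr0.
    by rewrite !submx0 => /eqP-> _; rewrite /bform !mul0mx mxE !addr0.
  by apply: polarizableD polW; apply: Clifford_simple (subsetP sXG x Xx).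
case=> _ [Q [QZ QD] Qinv]; split=> //; exists Q => [|x v Nx _].
  by split=> // u v _ _; apply: QD; rewrite defS submx1.
by apply: Qinv; rewrite // defS submx1.
Qed.

Lemma normal_quadratic_type : B != 0 -> quadratic_type rG.
Proof.
move=> nzB; have [_ [Q polQ Qinv]] := polarizable1; have [QZ QD] := polQ.
have [sNG nNG] := andP nsNG.
exists Q; split; first exact: polar_quadratic_form polQ.
  exact: polar_neq0 polQ nzB.
(* v |-> Q (v g) - Q v is additive because B is G-invariant. *)
move=> g v Gg; apply/eqP; rewrite -subr_eq0; apply/eqP.
move: v; apply: (inv_additive_eq0 nsNG irrG ntN) => [u v | x v Nx].
  rewrite mulmxDl !QD ?submx1 // (inv_formE _ _ invB) //; ring.
rewrite (Qinv x) ?submx1 //; congr (_ - _).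
have Gx := subsetP sNG x Nx.
(* Moving [x] past [g] replaces it by [x ^ g], again in [N], which [Q] ignores. *)
rewrite -mulmxA -repr_mxM // conjgC repr_mxM ?groupJ // mulmxA.
by rewrite Qinv ?submx1 // memJ_norm // (subsetP nNG).
Qed.

End Extend.

(** [B^T] is invariant too, so it is [c *: B]; transposing twice gives [c ^+ 2 = 1], and [c = 1] in
    characteristic 2. *)
Lemma inv_form_sym (F : fieldType) (gT : finGroupType) (G : {group gT}) n
    (rG : mx_representation F G n) (B : 'M_n) :
    2%N \in [pchar F] -> mx_absolutely_irreducible rG ->
    B \in unitmx -> inv_form rG B -> B^T = B.
Proof.
move=> charF2 absG unitB invB.
have invBt : inv_form rG B^T.
  by move=> x Gx; rewrite -{2}(invB x Gx) !trmx_mul trmxK mulmxA.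
have [c Dc] := inv_form_uniq absG invB unitB invBt.
have nzB : B != 0 by apply: unitmx_neq0 unitB; case/andP: absG.
have: (c ^+ 2 - 1) *: B = 0.
  apply/eqP; rewrite scalerBl scale1r subr_eq0 expr2 -scalerA -Dc.
  by rewrite -[X in _ == X]trmxK [in X in _ == X]Dc linearZ.
move/eqP; rewrite scaler_eq0 (negPf nzB) orbF subr_eq0 sqrf_eq1.
by rewrite oppr_pchar2 // orbb => /eqP c1; rewrite Dc c1 scale1r.
Qed.

(** * Induced modules *)

Section Induction.

Variables (F : fieldType) (gT : finGroupType) (G T : {group gT}) (n : nat).
Variables (rT : mx_representation F T n) (sTG : T \subset G).

Let k := #|rcosets T G|.
(** A sum rather than a product, to match the dimensions of block matrices. *)
Let m := (\sum_(i < k) n)%N.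

Definition ind_transversal (i : 'I_k) : gT := repr (enum_val i).
Local Notation t := ind_transversal.

Lemma ind_transversal_in i : t i \in G.
Proof.
have /rcosetsP[x Gx Dx] := enum_valP i.
rewrite /t Dx; have /rcosetP[y Ty ->] := mem_repr_rcoset T x.
by rewrite groupM // (subsetP sTG).
Qed.

Lemma ind_transversal_coset x i : (x * (t i)^-1 \in T)%g = (enum_val i == T :* x)%g.
Proof.
have /rcosetsP[y Gy Dy] := enum_valP i.
have -> : enum_val i = (T :* t i)%g by rewrite /t Dy rcoset_repr.
by rewrite -mem_rcoset eq_sym; apply/rcoset_eqP/eqP => ->.
Qed.

Lemma ind_transversal_ex x : x \in G -> {i | x * (t i)^-1 \in T}%g.
Proof.
move=> Gx; have TxG : (T :* x)%g \in rcosets T G by rewrite mem_rcosets mulSGid.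
by exists (enum_rank_in TxG (T :* x)%g); rewrite ind_transversal_coset enum_rankK_in.
Qed.

Lemma ind_transversal_uniq x i j :
  (x * (t i)^-1 \in T -> x * (t j)^-1 \in T -> i = j)%g.
Proof.
rewrite !ind_transversal_coset => /eqP Di /eqP Dj.
by apply: enum_val_inj; rewrite Di Dj.
Qed.

(* The inclusion of the i-th copy of 'rV_n in the induced module. *)
Definition blk (i : 'I_k) : 'M[F]_(n, m) :=
  \mxrow_(j < k) (if i == j then 1%:M else 0).

Lemma blk_mx p (u : 'M_(p, n)) i : u *m blk i = \mxrow_j (if i == j then u else 0).
Proof.
rewrite mul_mxrow; apply: eq_mxrow => j.
by case: eqP => _; rewrite ?mulmx1 ?mulmx0.
Qed.

Lemma mul_blk_tr p (u : 'M_(p, m)) i : u *m (blk i)^T = submxrow u i.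
Proof.
rewrite -[u in LHS]submxrowK tr_mxrow mul_mxrow_mxcol (bigD1 i) //=.
rewrite eqxx trmx1 mulmx1 big1 ?addr0 // => j /negPf nji.
by rewrite eq_sym nji trmx0 mulmx0.
Qed.

Lemma blkK i j : blk i *m (blk j)^T = if i == j then 1%:M else 0.
Proof. by rewrite mul_blk_tr mxrowK. Qed.

Lemma blk_free i : row_free (blk i).
Proof. by apply/row_freeP; exists (blk i)^T; rewrite blkK eqxx. Qed.

Lemma blkKm p i (u : 'M_(p, n)) : u *m blk i *m (blk i)^T = u.
Proof. by rewrite -mulmxA blkK eqxx mulmx1. Qed.

Lemma blk_sumE p (u : 'M_(p, m)) : \sum_i u *m (blk i)^T *m blk i = u.
Proof.
under eq_bigr => i _ do rewrite mul_blk_tr blk_mx.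
rewrite -mxrow_sum -[RHS]submxrowK; apply: eq_mxrow => j.
by rewrite -big_mkcond big_pred1_eq.
Qed.

Lemma blk_inj p (X Y : 'M_(m, p)) : (forall i, blk i *m X = blk i *m Y) -> X = Y.
Proof.
move=> eqXY; rewrite -[X]mul1mx -[Y]mul1mx -[1%:M]blk_sumE !mulmx_suml.
by apply: eq_bigr => i _; rewrite -!(mulmxA _ (blk i)) eqXY.
Qed.

Lemma blk_inj2 (X Y : 'M_m) :
  (forall i j, blk i *m X *m (blk j)^T = blk i *m Y *m (blk j)^T) -> X = Y.
Proof.
move=> eqXY; apply: blk_inj => i; rewrite -[LHS]blk_sumE -[RHS]blk_sumE.
by apply: eq_bigr => j _; rewrite eqXY.
Qed.

Definition bdiag (C : 'I_k -> 'M[F]_n) : 'M_m := \sum_i (blk i)^T *m C i *m blk i.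

Lemma blk_bdiag C i : blk i *m bdiag C = C i *m blk i.
Proof.
rewrite mulmx_sumr (bigD1 i) //= !mulmxA blkK eqxx mul1mx big1 ?addr0 // => j.
by rewrite eq_sym => /negPf nij; rewrite !mulmxA blkK nij !mul0mx.
Qed.

(** Block [i] stands for the summand $L \otimes t_i$: when $t_i x = y t_j$ with y in [T], the
    element [x] carries it to block [j] through [rT y]. *)
Definition ind_mx (x : gT) : 'M[F]_m :=
  \mxblock_(i < k, j < k)
    (let y := (t i * x * (t j)^-1)%g in if y \in T then rT y else 0).

Lemma blk_ind_mx x i j : (t i * x * (t j)^-1 \in T)%g ->
  blk i *m ind_mx x = rT (t i * x * (t j)^-1)%g *m blk j.
Proof.
move=> Tx; rewrite blk_mx mul_mxrow_mxblock; apply: eq_mxrow => l /=.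
rewrite (bigD1 i) //= eqxx mul1mx big1 ?addr0 => [|i' /negPf nii']; last first.
  by rewrite eq_sym nii' mul0mx.
have [<- | njl] := eqVneq j l; first by rewrite Tx.
by case: ifP => // Tl; case/eqP: njl; apply: ind_transversal_uniq Tx Tl.
Qed.

Lemma ind_mx_repr : mx_repr G ind_mx.
Proof.
split=> [|x y Gx Gy]; apply: blk_inj => i.
  have Ti : (t i * 1 * (t i)^-1 \in T)%g by rewrite mulg1 mulgV.
  by rewrite (blk_ind_mx Ti) mulg1 mulgV repr_mx1 mul1mx mulmx1.
have tG := ind_transversal_in.
have [j Tj] := ind_transversal_ex (groupM (tG i) Gx).
have [l Tl] := ind_transversal_ex (groupM (tG j) Gy).
have Txy : (t i * (x * y) * (t l)^-1 = (t i * x * (t j)^-1) * (t j * y * (t l)^-1))%g.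
  by rewrite !mulgA mulgKV.
rewrite mulmxA (blk_ind_mx Tj) -mulmxA (blk_ind_mx Tl) mulmxA -repr_mxM // -Txy.
by apply: blk_ind_mx; rewrite Txy groupM.
Qed.

Definition ind_repr := MxRepresentation ind_mx_repr.

Lemma blk_ind x i j : (t i * x * (t j)^-1 \in T)%g ->
  blk i *m ind_repr x = rT (t i * x * (t j)^-1)%g *m blk j.
Proof. exact: blk_ind_mx. Qed.

(** The summands are made mutually orthogonal; [G] permutes them, and its matrices from one to
    another come from [T], hence preserve [B]. *)
Lemma ind_inv_form B : inv_form rT B -> inv_form ind_repr (bdiag (fun=> B)).
Proof.
move=> invB x Gx; apply: blk_inj2 => i j.
have tG := ind_transversal_in.
have [i' Ti] := ind_transversal_ex (groupM (tG i) Gx).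
have [j' Tj] := ind_transversal_ex (groupM (tG j) Gx).
rewrite !mulmxA -[_ *m (blk j)^T]mulmxA -trmx_mul !blk_bdiag.
rewrite (blk_ind Ti) (blk_ind Tj).
rewrite -(mulmxA _ (blk i')) blk_bdiag trmx_mul !mulmxA.
rewrite -(mulmxA _ (blk i')) -(mulmxA _ (blk i)) !blkK.
have [Dij | nij] := eqVneq i j.
  have Dij' : i' = j' by apply: ind_transversal_uniq Ti _; rewrite Dij.
  by rewrite Dij Dij' eqxx !mulmx1 -Dij' -Dij invB.
suffices /negPf-> : i' != j' by rewrite !mulmx0 mul0mx.
apply: contraNneq nij => Dij'; apply/eqP.
rewrite -Dij' in Tj; apply: (@ind_transversal_uniq (t i)).
  by rewrite mulgV.
have -> : (t i * (t j)^-1 = (t i * x * (t i')^-1) * (t j * x * (t i')^-1)^-1)%g.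
  by rewrite !invMg invgK !mulgA mulgKV mulgK.
by rewrite groupM ?groupV.
Qed.

End Induction.

(** * Irreducibility of the induced module *)

Section InductionNormal.

Variables (F : fieldType) (gT : finGroupType) (G T N : {group gT}) (n : nat).
Variables (rT : mx_representation F T n) (sTG : T \subset G).
Variables (nsNG : (N <| G)%g) (sNT : N \subset T).

Local Notation t := (@ind_transversal _ G T).
Local Notation blk := (@blk F _ G T n).
Local Notation rI := (ind_repr rT sTG).

Let sNG := normal_sub nsNG.

Lemma blk_ind_normal x i : x \in N -> blk i *m rI x = rT (x ^ (t i)^-1)%g *m blk i.
Proof.
move=> Nx; have Dx : (x ^ (t i)^-1 = t i * x * (t i)^-1)%g.
  by rewrite conjgE invgK mulgA.
rewrite Dx; apply: blk_ind; rewrite -Dx (subsetP sNT) // memJ_norm //.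
by rewrite groupV (subsetP (normal_norm nsNG)) ?ind_transversal_in.
Qed.

Hypothesis irrN : mx_irreducible (subg_repr rT sNT).

Let rN := subg_repr rI sNG.

(** [N] acts on block [i] by a conjugate of an irreducible module, and submodules of the conjugate
    are submodules of the original. *)
Lemma blk_simple i : mxsimple rN <<blk i>>%MS.
Proof.
have [n_gt0 minN] := (mx_irrP _).1 irrN.
have freeb : row_free (blk i) by apply: blk_free.
have JN y : y \in N -> (y ^ t i \in N)%g.
  by rewrite memJ_norm // (subsetP (normal_norm nsNG)) ?ind_transversal_in.
split.
- apply/mxmoduleP=> x Nx; rewrite (eqmxMr _ (genmxE _)) genmxE.
  by rewrite [rN x]/(rI x) blk_ind_normal // submxMl.
- by rewrite -mxrank_eq0 genmxE (eqP freeb) -lt0n.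
move=> V modV; rewrite !genmxE => /submxP[W DV] nzV.
have: row_full <<W>>%MS.
  apply: minN; last first.
    rewrite -mxrank_eq0 genmxE mxrank_eq0.
    by apply: contraNneq nzV => W0; rewrite DV W0 mul0mx.
  apply/mxmoduleP=> y Ny; rewrite (eqmxMr _ (genmxE _)) genmxE.
  have := mxmoduleP modV _ (JN y Ny); rewrite {1}DV -mulmxA [rN _]/(rI _).
  rewrite blk_ind_normal ?JN // conjgK mulmxA DV => /(submxMr (blk i)^T).
  by rewrite !blkKm.
by rewrite -sub1mx genmxE => /(submxMr (blk i)); rewrite mul1mx -DV.
Qed.

(** In coordinates, an isomorphism of the blocks is an intertwiner for $t_i t_j^{-1}$; the
    hypothesis puts this element in [T], so both representatives lie in the same coset. *)
Lemma blk_inertia i j :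
    (forall g A, g \in G -> A \in unitmx ->
      (forall x, x \in N -> A *m rT x = rT (x ^ g^-1)%g *m A) -> g \in T) ->
  mx_iso rN <<blk i>>%MS <<blk j>>%MS -> i = j.
Proof.
move=> inertT [f unitf homf eqf].
pose C := blk i *m f *m (blk j)^T.
have bf : blk i *m f = C *m blk j.
  have /submxP[D DD] : (blk i *m f <= blk j)%MS.
    by rewrite -(genmxE (blk j)) -eqf submxMr // genmxE.
  by rewrite /C DD blkKm.
have unitC : C \in unitmx.
  have: row_free (blk i *m f).
    by rewrite /row_free mxrankMfree ?row_free_unit //; apply: blk_free.
  by rewrite bf /row_free mxrankMfree ?blk_free // -row_free_unit.
have tG l := ind_transversal_in sTG l.
have nG l : t l \in 'N(N)%g by rewrite (subsetP (normal_norm nsNG)).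
apply: (@ind_transversal_uniq _ _ _ (t i)); first by rewrite mulgV.
apply: inertT unitC _ => [|x Nx]; first by rewrite groupM ?groupV.
have Nxj : (x ^ t j \in N)%g by rewrite memJ_norm.
have: (blk i <= dom_hom_mx rN f)%MS by rewrite -(genmxE (blk i)).
move/hom_mxP/(_ _ Nxj); rewrite [rN _]/(rI _) blk_ind_normal // -mulmxA bf.
rewrite -[RHS]mulmxA blk_ind_normal // conjgK !mulmxA => /(congr1 (mulmx^~ (blk j)^T)).
by rewrite !blkKm invMg invgK conjgM.
Qed.

(* Restricted to N, the blocks are simple and pairwise non-isomorphic, so any   *)
(* nonzero submodule contains one of them, and G permutes them transitively.   *)
Lemma ind_irr :
    (forall g A, g \in G -> A \in unitmx ->
      (forall x, x \in N -> A *m rT x = rT (x ^ g^-1)%g *m A) -> g \in T) ->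
  mx_irreducible rI.
Proof.
move=> inertT; have [n_gt0 _] := (mx_irrP _).1 irrN.
have tG l := ind_transversal_in sTG l.
have [i0 _] := ind_transversal_ex sTG (group1 G).
apply/mx_irrP; split.
  by rewrite (bigD1 i0) //= addn_gt0 n_gt0.
move=> U modU nzU.
have modNU : mxmodule rN U by apply: mxmodule_subg.
apply: (mxsimple_exists modNU nzU) => -[V simV sVU].
have [modV nzV _] := simV.
(* The projection onto block [i], which commutes with [N]; by Schur's lemma a simple [V] projects to
   0 or isomorphically. *)
pose p i := (blk i)^T *m blk i.
have homp i : (V <= dom_hom_mx rN (p i))%MS.
  apply: centgmx_hom; apply/centgmxP=> x Nx; apply: blk_inj => j.
  rewrite /p !mulmxA [rN x]/(rI x) blk_ind_normal // blkK.
  rewrite -!mulmxA (mulmxA (blk j) (blk i)^T) blkK.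
  have [-> | nij] := eqVneq j i; last by rewrite !mul0mx mulmx0.
  by rewrite !mul1mx blk_ind_normal.
have isop i : V *m p i != 0 -> (V *m p i :=: <<blk i>>)%MS /\ mx_iso rN V <<blk i>>%MS.
  move=> nzVi; have Dp : (V *m p i :=: <<blk i>>)%MS.
    apply: (mx_Schur_onto modV (blk_simple i) (homp i)) => //.
    by rewrite genmxE mulmxA submxMl.
  split=> //; apply: mx_iso_trans (mx_Schur_inj_iso simV (homp i) nzVi) _.
  exact: eqmx_iso.
have [i nzVi] : exists i, V *m p i != 0.
  apply/existsP; apply: contraR nzV; rewrite negb_exists => /forallP V0.
  rewrite -[V]blk_sumE; apply/eqP/big1 => i _; rewrite -mulmxA; apply/eqP.
  by have := V0 i; rewrite negbK.
have [Di isoi] := isop i nzVi.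
have DV : V = V *m p i.
  rewrite -[LHS]blk_sumE [LHS](bigD1 i) //= [X in _ + X = _]big1 => [|j nji].
    by rewrite addr0 -mulmxA.
  rewrite -mulmxA; apply/eqP; apply: contraNT nji => nzVj.
  have [_ isoj] := isop j nzVj; apply/eqP; apply: (blk_inertia inertT).
  exact: mx_iso_trans (mx_iso_sym isoj) isoi.
have sbU j : (blk j <= U)%MS.
  have sbiU : (blk i <= U)%MS by rewrite -(genmxE (blk i)) -Di -DV.
  have Tij : (t i * ((t i)^-1 * t j) * (t j)^-1 \in T)%g by rewrite mulKVg mulgV.
  have := blk_ind rT sTG Tij; rewrite mulKVg mulgV repr_mx1 mul1mx => <-.
  have Gij : ((t i)^-1 * t j \in G)%g by rewrite groupM ?groupV.
  exact: submx_trans (submxMr _ sbiU) (mxmoduleP modU _ Gij).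
rewrite -sub1mx -[1%:M]blk_sumE summx_sub // => j _.
by rewrite mulmx_sub.
Qed.

End InductionNormal.

(** * Extending an irreducible module to its inertia group *)

(** For odd [m], [c] equals [c ^+ m.+1], an even power. For even [m], [c ^+ m./2] squares to 1, so
    it is 1 in characteristic 2, and the exponent can be halved. *)
Lemma root_of_unity_sqrt (F : fieldType) (c : F) m :
  2%N \in [pchar F] -> (0 < m)%N -> c ^+ m = 1 -> exists d, d ^+ 2 = c.
Proof.
move=> charF2; have [p] := ubnP m; elim: p m => // p IHp m lemp m_gt0 cm1.
have := odd_double_half m; case: (odd m) => [Dm | /= Dm].
  exists (c ^+ (m./2).+1); rewrite -exprM muln2 doubleS exprS.
  by rewrite -add1n Dm cm1 mulr1.
have h_gt0 : (0 < m./2)%N by rewrite -double_gt0 -[_.*2]add0n Dm.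
apply: (IHp m./2) => //.
  by rewrite -ltnS (leq_trans _ lemp) // ltnS -{2}Dm add0n -addnn -addn1 leq_add2l.
have : (c ^+ m./2) ^+ 2 == 1 by rewrite -exprM muln2 -[_.*2]add0n Dm cm1.
by rewrite sqrf_eq1 oppr_pchar2 // orbb => /eqP.
Qed.

Section Intertwiners.

Variables (F : fieldType) (gT : finGroupType) (N : {group gT}) (n : nat).
Variable rN : mx_representation F N n.

(** The relation $g x = x^{g^{-1}} g$, which the matrix of [g] satisfies in any extension of
    [rN]. *)
Definition intertwines (g : gT) (A : 'M[F]_n) :=
  {in N, forall x, A *m rN x = rN (x ^ g^-1)%g *m A}.

Lemma intertwines_repr x : x \in N -> intertwines x (rN x).
Proof.
by move=> Nx y Ny; rewrite -!repr_mxM ?groupJ ?groupV // conjgE invgK mulgA mulgKV.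
Qed.

Lemma intertwinesM g h A C : h \in 'N(N)%g ->
  intertwines g A -> intertwines h C -> intertwines (g * h)%g (A *m C).
Proof.
move=> nNh iA iC x Nx; rewrite -mulmxA iC // mulmxA iA ?memJ_norm ?groupV //.
by rewrite mulmxA invMg conjgM.
Qed.

Lemma intertwinesV g A : g \in 'N(N)%g -> A \in unitmx ->
  intertwines g A -> intertwines g^-1%g (invmx A).
Proof.
move=> nNg uA iA x Nx; rewrite invgK; apply: (can_inj (mulKmx uA)).
rewrite mulKVmx // mulmxA iA ?memJ_norm // conjgK.
by rewrite mulmxK.
Qed.

Lemma intertwinesX g A m : g \in 'N(N)%g ->
  intertwines g A -> intertwines (g ^+ m)%g (A ^+ m).
Proof.
move=> nNg iA; elim: m => [|m IHm].
  by move=> x Nx; rewrite expg0 expr0 invg1 conjg1 mul1mx mulmx1.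
by rewrite expgS exprS; apply: intertwinesM => //; rewrite groupX.
Qed.

Lemma intertwines_inj g A C :
    mx_absolutely_irreducible rN -> g \in 'N(N)%g -> C \in unitmx ->
  intertwines g A -> intertwines g C -> exists s, A = s *: C.
Proof.
move=> absN nNg uC iA iC.
have := intertwinesM (groupVr nNg) iA (intertwinesV nNg uC iC); rewrite mulgV => iAC.
have /(mx_abs_irr_cent_scalar absN)/is_scalar_mxP[s Ds] : centgmx rN (A *m invmx C).
  by apply/centgmxP=> x Nx; rewrite iAC // invg1 conjg1.
by exists s; rewrite -mul_scalar_mx -Ds mulmxKV.
Qed.

Lemma abs_irr_span (X : 'M[F]_n) : mx_absolutely_irreducible rN ->
  exists a : gT -> F, X = \sum_(x in N) a x *: rN x.
Proof.
by case/andP=> _ fullN; apply/envelop_mxP; apply: submx_full.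
Qed.

End Intertwiners.

(** * Rescaling an intertwiner to finite order *)

Section CyclicExtension.

Variables (F : fieldType) (gT : finGroupType) (N : {group gT}) (n : nat).
Variables (rN : mx_representation F N n) (g : gT) (A : 'M[F]_n).
Hypotheses (nNg : g \in 'N(N)%g) (absN : mx_absolutely_irreducible rN).
Hypotheses (unitA : A \in unitmx) (iA : intertwines rN g A).

Let H := (<[g]> <*> N)%G.
Hypothesis splitH : group_splitting_field F H.

Let sNH : N \subset H. Proof. exact: joing_subr. Qed.
Let Hg : g \in H. Proof. by rewrite mem_gen // inE cycle_id. Qed.
Let nNH : H \subset 'N(N)%g. Proof. by rewrite join_subG cycle_subG nNg normG. Qed.
Let nsNH : (N <| H)%g. Proof. exact/andP. Qed.

Local Notation t := (@ind_transversal _ H N).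
Local Notation blk := (@blk F _ H N n).
Local Notation rI := (ind_repr rN sNH).

Lemma cyclic_intertwiner h : h \in H -> exists2 C, C \in unitmx & intertwines rN h C.
Proof.
rewrite /H /= norm_joinEl ?cycle_subG // => /mulsgP[x y /cycleP[i ->] Ny ->].
exists (A ^+ i *m rN y).
  rewrite unitmx_mul repr_mx_unit // andbT.
  by elim: i => [|i IHi]; rewrite ?expr0 ?unitmx1 // exprS unitmx_mul unitA.
apply: intertwinesM; first exact: subsetP (normG N) y Ny.
  exact: intertwinesX.
exact: intertwines_repr.
Qed.

(** Conjugation by an intertwiner [C i] for the [i]-th representative turns [rN x] into the action
    of [x] on block [i]. Performed in all blocks at once, it is an algebra morphism carrying [rN] to
    the induced action of [N]. *)
Lemma ind_algebra_morphism :
  exists Phi : 'M[F]_n -> 'M[F]_(\sum_(i < #|rcosets N H|) n),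
  [/\ forall X Y, Phi (X *m Y) = Phi X *m Phi Y, forall s, Phi s%:M = s%:M
    & forall a : gT -> F, forall X : gT -> 'M_n,
        Phi (\sum_(x in N) a x *: X x) = \sum_(x in N) a x *: Phi (X x)]
  /\ {in N, forall x, Phi (rN x) = rI x}.
Proof.
have /fin_all_exists[C CP] (i : 'I_#|rcosets N H|) :
    exists C, C \in unitmx /\ intertwines rN (t i) C.
  have [C uC iC] := cyclic_intertwiner (ind_transversal_in sNH i).
  by exists C.
have uC i := (CP i).1; have iC i := (CP i).2.
exists (fun X => bdiag (fun i => C i *m X *m invmx (C i))); split; first split.
- move=> X Y; apply: blk_inj => i; rewrite mulmxA !blk_bdiag.
  by rewrite -(mulmxA _ (blk i)) blk_bdiag !mulmxA mulmxKV.
- move=> s; apply: blk_inj => i; rewrite blk_bdiag scalar_mxC mulmxK //.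
  by rewrite scalar_mxC.
- move=> a X; apply: blk_inj => i; rewrite blk_bdiag !mulmx_sumr !mulmx_suml.
  by apply: eq_bigr => x _; rewrite -!scalemxAr -!scalemxAl blk_bdiag.
move=> x Nx; apply: blk_inj => i; rewrite blk_bdiag iC // mulmxK //.
by rewrite (blk_ind_normal rN sNH nsNH (subxx N)).
Qed.

(* Phi(A)^-1 *m rI g centralizes the induced module and lies in its enveloping *)
(* algebra, so it acts as a scalar s on a simple submodule, F being a splitting *)
(* field for H. Raising this to the power #[g] gives A^-#[g] = s^#[g].          *)
Lemma cyclic_intertwiner_scalar : exists s m,
  (0 < m)%N /\ (invmx A) ^+ m = (s ^+ m)%:M.
Proof.
have [Phi [[PhiM Phis PhiD] PhiN]] := ind_algebra_morphism.
have PhiE X : exists a : gT -> F, X = \sum_(x in N) a x *: rN x /\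
                 Phi X = \sum_(x in N) a x *: rI x.
  have [a ->] := abs_irr_span X absN; exists a; split=> //.
  by rewrite PhiD; apply: eq_bigr => x Nx; rewrite PhiN.
have NJ x : x \in N -> (x ^ g^-1 \in N)%g by move=> Nx; rewrite memJ_norm // groupV.
have inH := subsetP sNH.
have rIJ x : x \in N -> rI g *m rI x = rI (x ^ g^-1)%g *m rI g.
  move=> Nx; rewrite -!repr_mxM ?(inH _ Nx) ?(inH _ (NJ x Nx)) ?Hg // conjgE invgK.
  by rewrite mulgA mulgKV.
have PhiJ X : rI g *m Phi X = Phi (A *m X *m invmx A) *m rI g.
  have [a [DX ->]] := PhiE X.
  have -> : A *m X *m invmx A = \sum_(x in N) a x *: rN (x ^ g^-1)%g.
    rewrite DX mulmx_sumr mulmx_suml; apply: eq_bigr => x Nx.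
    by rewrite -scalemxAr -scalemxAl iA // mulmxK.
  rewrite PhiD mulmx_suml mulmx_sumr; apply: eq_bigr => x Nx.
  by rewrite -scalemxAr -scalemxAl rIJ // PhiN ?NJ.
pose Z := Phi (invmx A) *m rI g.
have cZ : centgmx rI Z.
  suffices: H \subset rcent rI Z by [].
  rewrite /H join_subG cycle_subG; apply/andP; split.
    rewrite inE Hg; apply/eqP; rewrite /Z [RHS]mulmxA PhiJ.
    by rewrite mulmxV // mul1mx.
  apply/subsetP=> x Nx; rewrite inE inH //; apply/eqP.
  rewrite /Z -mulmxA rIJ // !mulmxA -(PhiN x) // -(PhiN (x ^ g^-1)%g) ?NJ //.
  rewrite -!PhiM; congr (Phi _ *m _).
  have := intertwinesV nNg unitA iA (NJ x Nx).
  by rewrite invgK conjgKV => ->.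
have envZ : (Z \in enveloping_algebra_mx rI)%MS.
  apply: envelop_mxM (envelop_mx_id rI Hg).
  have [a [_ ->]] := PhiE (invmx A).
  rewrite linear_sum summx_sub // => x Nx; rewrite linearZ scalemx_sub //.
  by rewrite envelop_mx_id ?inH.
(* By [PhiJ], [rI g] conjugates [Phi X] as [A] conjugates [X], so it commutes with the image of any
   power of [invmx A]. *)
have ZX j : Z ^+ j = Phi (invmx A ^+ j) *m rI (g ^+ j)%g.
  elim: j => [|j IHj]; first by rewrite !expr0 expg0 repr_mx1 Phis mulmx1.
  rewrite exprS IHj /Z -[_ * _]/(_ *m _) !mulmxA -(mulmxA _ (rI g)) PhiJ.
  have -> : A *m invmx A ^+ j *m invmx A = invmx A ^+ j.
    by rewrite -mulmxA -[_ *m invmx A]/(_ * _) -exprSr exprS mulKVmx.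
  rewrite mulmxA -PhiM -[invmx A *m _]/(_ * _) -exprS.
  by rewrite -mulmxA -repr_mxM ?groupX // -expgS.
have nz1 : (1%:M : 'M[F]_(\sum_(i < #|rcosets N H|) n)) != 0.
  have [i _] := ind_transversal_ex sNH (group1 H).
  apply/eqP=> I0; have := @blkK F _ H N n i i.
  rewrite eqxx -[blk i]mulmx1 I0 mulmx0 mul0mx.
  move=> /(congr1 (@mxrank _ _ _))/eqP.
  rewrite mxrank0 mxrank1 eq_sym; have /andP[n_gt0 _] := absN.
  by rewrite -[_ == _]negbK -lt0n n_gt0.
apply/asboolP; apply: (mxsimple_exists (mxmodule1 rI) nz1) => -[U simU _].
apply/asboolP.
have [modU nzU _] := simU.
pose rU := submod_repr modU.
pose V : 'M_(\rank U, _) := @val_submod _ _ U _ 1%:M.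
pose ZU := in_submod U (V *m Z).
have DZU : val_submod ZU = V *m Z.
  by rewrite in_submodK // (mxmodule_envelop modU envZ) // val_submodP.
have valM (X W : 'M_(\rank U)) :
    @val_submod _ _ U _ (X *m W) = X *m @val_submod _ _ U _ W.
  by rewrite val_submodE -mulmxA -val_submodE.
have rUV x : x \in H -> rU x *m V = V *m rI x.
  by move=> Hx; rewrite /V -valM mulmx1 -[rU x]mul1mx val_submodJ.
have cZU : centgmx rU ZU.
  apply/centgmxP=> x Hx; apply: (@val_submod_inj _ _ U).
  rewrite val_submodJ // valM DZU (mulmxA (rU x) V Z) rUV //.
  by rewrite -[LHS]mulmxA -[RHS]mulmxA (centgmxP cZ).
have absU := splitH ((submod_mx_irr modU).2 simU).
have /is_scalar_mxP[s Ds] := mx_abs_irr_cent_scalar absU cZU.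
have VZ : V *m Z = s *: V by rewrite -DZU Ds val_submodE mul_scalar_mx.
exists s, #[g]%g; split; first exact: order_gt0.
have := intertwinesX #[g]%g (groupVr nNg) (intertwinesV nNg unitA iA).
rewrite expgVn expg_order invg1 => iAm.
have /(mx_abs_irr_cent_scalar absN)/is_scalar_mxP[r Dr] :
  centgmx rN (invmx A ^+ #[g]%g).
  by apply/centgmxP=> x Nx; rewrite iAm // invg1 conjg1.
have VZX j : V *m Z ^+ j = s ^+ j *: V.
  elim: j => [|j IHj]; first by rewrite !expr0 mulmx1 scale1r.
  by rewrite exprSr mulmxA IHj -scalemxAl VZ scalerA -exprSr.
(* On the non-zero [U], the power [Z ^+ #[g]] acts both as [r], since [g ^+ #[g]] is 1, and as [s ^+
   #[g]]. *)
rewrite Dr; congr _%:M; have := VZX #[g]%g.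
rewrite ZX expg_order repr_mx1 mulmx1 Dr Phis mul_mx_scalar => /eqP.
rewrite -subr_eq0 -scalerBl scaler_eq0 => /orP[|V0]; first by rewrite subr_eq0 => /eqP.
case/negP: nzU; rewrite -mxrank_eq0.
by rewrite -(val_submod1 U) mxrank_eq0.
Qed.

End CyclicExtension.

(** * Isometric intertwiners and the inertia group *)

Section IsometricExtension.

Variables (F : fieldType) (gT : finGroupType) (G N : {group gT}) (n : nat).
Variables (rN : mx_representation F N n) (B : 'M[F]_n).
Hypotheses (nsNG : (N <| G)%g) (charF2 : 2%N \in [pchar F]).
Hypothesis splitF :
  forall H : {group gT}, H \subset G -> group_splitting_field F H.
Hypotheses (irrN : mx_irreducible rN) (unitB : B \in unitmx).
Hypothesis invB : inv_form rN B.

Let sNG := normal_sub nsNG.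
Let absN : mx_absolutely_irreducible rN := splitF sNG irrN.
Let nN g : g \in G -> g \in 'N(N)%g.
Proof. exact: (subsetP (normal_norm nsNG)). Qed.

Let nzB : B != 0.
Proof. by apply: unitmx_neq0 unitB; case/andP: absN. Qed.

(** [A] multiplies the form by some [c] by Schur's lemma. A multiple [s *: A] has finite order, so
    its multiplier [c * s ^+ 2] is a root of unity, hence a square [e ^+ 2], and [d] is [e / s]. *)
Lemma scaled_isometry_sqrt g A : g \in G -> A \in unitmx -> intertwines rN g A ->
  exists2 d, d != 0 & A *m B *m A^T = d ^+ 2 *: B.
Proof.
move=> Gg unitA iA.
have invC : inv_form rN (A *m B *m A^T).
  move=> x Nx; have Nxg : (x ^ g \in N)%g by rewrite memJ_norm ?nN.
  have Ax : rN x *m A = A *m rN (x ^ g)%g by rewrite iA // conjgK.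
  rewrite !mulmxA Ax -!mulmxA -trmx_mul Ax trmx_mul !mulmxA.
  by rewrite -!(mulmxA A) (invB Nxg).
have [c Dc] := inv_form_uniq absN invB unitB invC.
have sHG : (<[g]> <*> N \subset G)%g by rewrite join_subG cycle_subG Gg.
have [s [m [m_gt0 Ds]]] :=
  cyclic_intertwiner_scalar (nN Gg) absN unitA iA (splitF sHG).
have DB1 : B = c *: (invmx A *m B *m (invmx A)^T).
  rewrite scalemxAl scalemxAr -Dc !mulmxA mulVmx // mul1mx -mulmxA -trmx_mul.
  by rewrite mulVmx // trmx1 mulmx1.
have DB j : B = c ^+ j *: (invmx A ^+ j *m B *m (invmx A ^+ j)^T).
  elim: j => [|j IHj]; first by rewrite !expr0 trmx1 mulmx1 mul1mx scale1r.
  rewrite {1}IHj exprSr -scalerA; congr (_ *: _); rewrite [in LHS]DB1.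
  rewrite -scalemxAr -scalemxAl exprSr -[_ * _]/(_ *m _) trmx_mul.
  by rewrite !mulmxA.
have cm1 : (c * s ^+ 2) ^+ m = 1.
  have := DB m; rewrite Ds tr_scalar_mx mul_scalar_mx -scalemxAl mul_mx_scalar.
  rewrite !scalerA -{1}[B]scale1r => /eqP; rewrite -subr_eq0 -scalerBl.
  rewrite scaler_eq0 (negPf nzB) orbF subr_eq0 => /eqP.
  by rewrite exprMn -exprM mulnC exprM expr2 mulrA.
have [e De] := root_of_unity_sqrt charF2 m_gt0 cm1.
have nz : c * s ^+ 2 != 0.
  by apply: contra_eq_neq cm1 => ->; rewrite expr0n eqn0Ngt m_gt0 eq_sym oner_eq0.
move: nz; rewrite mulf_eq0 negb_or expf_eq0 /= => /andP[nzc nzs].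
exists (e / s); last by rewrite Dc expr_div_n De mulfK ?expf_neq0.
apply: contraNneq nzc => es0; have e0 : e = 0.
  by apply/eqP; move/eqP: es0; rewrite mulf_eq0 invr_eq0 (negPf nzs) orbF.
by move/eqP: De; rewrite e0 expr0n eq_sym mulf_eq0 expf_eq0 /= (negPf nzs) orbF.
Qed.

Definition isometric g (A : 'M[F]_n) := A *m B *m A^T = B /\ intertwines rN g A.

Lemma isometric_unit g A : isometric g A -> A \in unitmx.
Proof.
case=> AB _; suffices: A *m (B *m A^T *m invmx B) = 1%:M by case/mulmx1_unit.
by rewrite !mulmxA AB mulmxV.
Qed.

Lemma isometricM g h A C : h \in G ->
  isometric g A -> isometric h C -> isometric (g * h)%g (A *m C).
Proof.
move=> Gh [AB iA] [CB iC]; split; last exact: intertwinesM (nN Gh) iA iC.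
by rewrite trmx_mul !mulmxA -!(mulmxA A) CB !mulmxA.
Qed.

(* The sign in "unique up to sign" disappears in characteristic 2. *)
Lemma isometric_inj g A C : g \in G -> isometric g A -> isometric g C -> A = C.
Proof.
move=> Gg isoA isoC; have [AB iA] := isoA; have [CB iC] := isoC.
have [s Ds] := intertwines_inj absN (nN Gg) (isometric_unit isoC) iA iC.
have := AB; rewrite Ds -!scalemxAl linearZ -scalemxAr CB scalerA -expr2 => /eqP.
rewrite -{2}[B]scale1r -subr_eq0 -scalerBl scaler_eq0 (negPf nzB) orbF.
rewrite subr_eq0 sqrf_eq1 oppr_pchar2 // orbb => /eqP->.
by rewrite scale1r.
Qed.

Lemma isometric_repr x : x \in N -> isometric x (rN x).
Proof. by move=> Nx; split; [apply: invB | apply: intertwines_repr]. Qed.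

(** [T] consists of the elements admitting an isometric intertwiner; uniqueness of that intertwiner
    makes the choice [f] multiplicative and equal to [rN] on [N]. Rescaling any invertible
    intertwiner by [d^-1] shows that [T] is the full inertia group. *)
Lemma inertia_extension : exists (T : {group gT}) (rT : mx_representation F T n),
  [/\ N \subset T, T \subset G, {in N, rT =1 rN}, inv_form rT B
    & forall g A, g \in G -> A \in unitmx -> intertwines rN g A -> g \in T].
Proof.
pose T := [set g in G | `[< exists A, isometric g A >]].
have TG g : g \in T -> g \in G by rewrite inE => /andP[].
have gT_T : group_set T.
  apply/group_setP; split=> [|g h]; rewrite ?inE ?group1 /=.
    by apply/asboolP; exists (rN 1%g); apply: isometric_repr.
  case/andP=> Gg /asboolP[A isoA] /andP[Gh /asboolP[C isoC]].
  by rewrite groupM //; apply/asboolP; exists (A *m C); apply: isometricM.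
have /fin_all_exists[f fP] (g : gT) : exists A, g \in T -> isometric g A.
  have [Tg | nTg] := boolP (g \in T); last by exists 0.
  by move: Tg; rewrite inE => /andP[_ /asboolP[A isoA]]; exists A.
have fN x : x \in N -> f x = rN x.
  move=> Nx; have Gx := subsetP sNG x Nx.
  apply: isometric_inj Gx (fP x _) (isometric_repr Nx).
  by rewrite inE (subsetP sNG) //; apply/asboolP; exists (rN x); apply: isometric_repr.
have f_repr : mx_repr (Group gT_T) f.
  split=> [|g h Tg Th]; first by rewrite fN // repr_mx1.
  apply: isometric_inj (isometricM (TG h Th) (fP g Tg) (fP h Th)).
    by rewrite groupM ?TG.
  by apply: fP; apply: (groupM (G := Group gT_T)).
exists (Group gT_T), (MxRepresentation f_repr); split=> //.
- apply/subsetP=> x Nx; rewrite inE (subsetP sNG) //; apply/asboolP.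
  by exists (rN x); apply: isometric_repr.
- exact/subsetP.
- by move=> g Tg; have [] := fP g Tg.
move=> g A Gg unitA iA; rewrite inE Gg; apply/asboolP.
have [d nzd AB] := scaled_isometry_sqrt Gg unitA iA.
exists (d^-1 *: A); split.
  rewrite -!scalemxAl linearZ -scalemxAr AB !scalerA -expr2 -exprMn mulVf //.
  by rewrite expr1n scale1r.
by move=> x Nx; rewrite -scalemxAl iA // scalemxAr.
Qed.

End IsometricExtension.

(** * Passing between [G], [N] and [G / N] *)

Lemma normal_all_quadratic_type (F : fieldType) (gT : finGroupType)
    (G N : {group gT}) :
    (N <| G)%g -> 2%N \in [pchar F] ->
    (forall H : {group gT}, H \subset G -> group_splitting_field F H) ->
  all_quadratic_type F G -> all_quadratic_type F N.
Proof.
move=> nsNG charF2 splitF quadG n rN irrN /self_dual_form[B unitB invB] ntN.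
have [T [rT [sNT sTG rTN invT inertT]]] :=
  inertia_extension nsNG charF2 splitF irrN unitB invB.
have sNG := normal_sub nsNG.
have NJ g x : g \in G -> x \in N -> (x ^ g \in N)%g.
  by move=> Gg Nx; rewrite memJ_norm // (subsetP (normal_norm nsNG)).
have irrT : mx_irreducible (subg_repr rT sNT).
  apply: (mx_rsim_irr _ irrN); exists 1%:M; rewrite ?row_free_unit ?unitmx1 //.
  by move=> x Nx; rewrite mulmx1 mul1mx /= rTN.
pose rI := ind_repr rT sTG.
have irrI : mx_irreducible rI.
  apply: (ind_irr sTG nsNG irrT) => g A Gg unitA iA.
  apply: inertT unitA _ => // x Nx; have := iA x Nx.
  by rewrite !rTN ?NJ ?groupV.
have [i _] := ind_transversal_ex sTG (group1 G).
pose b := @blk F _ G T n i.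
have bK : b *m b^T = 1%:M by rewrite blkK eqxx.
pose t := ind_transversal i.
have Gt : t \in G by apply: ind_transversal_in.
(* The representative [t] need not be 1: block [i] carries a conjugate of L, and conjugating by [t]
   undoes the twist. *)
have bN x : x \in N -> b *m rI (x ^ t)%g = rN x *m b.
  by move=> Nx; rewrite (blk_ind_normal rT sTG nsNG sNT) ?NJ // conjgK rTN.
pose C : 'M[F]_(\sum_(i < #|rcosets T G|) n) := bdiag (fun=> B).
have bC : b *m C = B *m b by apply: blk_bdiag.
have nzB : B != 0 by apply: unitmx_neq0 unitB; case/mx_irrP: irrN.
have invC : inv_form rI C by apply: ind_inv_form.
have unitC : C \in unitmx.
  apply: (inv_form_unit irrI invC); apply: contraNneq nzB => C0.
  by rewrite -[B]mulmx1 -bK mulmxA -bC C0 mulmx0 mul0mx.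
have sdI : self_dual rI by apply/self_dual_form; exists C.
have ntI : ~~ (G \subset rker rI).
  apply: contra ntN => /subsetP trivG; apply/subsetP=> x Nx; apply/rkerP; split=> //.
  have /rkerP[_ rx1] := trivG _ (subsetP sNG _ (NJ t x Gt Nx)).
  have := bN x Nx; rewrite rx1 mulmx1 => /(congr1 (mulmx^~ b^T)).
  by rewrite -mulmxA bK mulmx1.
have [P [Q [unitP invP [QZ QD] Qinv]]] :=
  quadratic_form_unit_polar irrI ntI (quadG _ _ irrI sdI ntI).
(* The polar form of [Q] is a non-zero multiple of [C], so pulling [Q] back to L along [b] gives
   polar form [c *: B], which is non-zero. *)
have [c Dc] := inv_form_uniq (splitF G (subxx G) _ _ irrI) invC unitC invP.
pose q v := Q (v *m b).
have bP : b *m P *m b^T = c *: B.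
  by rewrite Dc -scalemxAr bC -scalemxAl -mulmxA bK mulmx1.
have polq : polar_on 1%:M (c *: B) q.
  split=> [a v | u v _ _]; rewrite /q; first by rewrite -scalemxAl QZ.
  by rewrite mulmxDl QD ?submx1 // bform_mul bP.
have nzcB : c *: B != 0.
  rewrite scaler_eq0 (negPf nzB) orbF; have [I_gt0 _] := (mx_irrP rI).1 irrI.
  by apply: contraTneq (unitmx_neq0 I_gt0 unitP) => c0; rewrite Dc c0 scale0r eqxx.
exists q; split; first exact: polar_quadratic_form polq.
  exact: polar_neq0 polq nzcB.
move=> x v Nx; rewrite /q -mulmxA -bN // mulmxA Qinv //.
exact: subsetP sNG _ (NJ t x Gt Nx).
Qed.

(** Inflation along [coset N] keeps the matrices, hence the submodules, the invariant forms and
    non-triviality. *)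
Lemma quotient_all_quadratic_type (F : fieldType) (gT : finGroupType)
    (G N : {group gT}) :
  (N <| G)%g -> all_quadratic_type F G -> all_quadratic_type F (G / N)%G.
Proof.
move=> nsNG quadG n rQ irrQ /self_dual_form[B unitB invB] ntQ.
have nNG := normal_norm nsNG.
have rG_repr : mx_repr G (fun x => rQ (coset N x)).
  split=> [|x y Gx Gy]; first by rewrite coset_id // repr_mx1.
  by rewrite coset_morphM ?(subsetP nNG) // repr_mxM ?mem_quotient.
pose rG := MxRepresentation rG_repr.
have cosetP (y : coset_of N) : y \in (G / N)%g -> exists2 x, x \in G & y = coset N x.
  by case/morphimP=> x _ Gx ->; exists x.
have irrG : mx_irreducible rG.
  have [n_gt0 minQ] := (mx_irrP _).1 irrQ; apply/mx_irrP; split=> // U modU.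
  apply: minQ; apply/mxmoduleP=> y /cosetP[x Gx ->].
  exact: (mxmoduleP modU x Gx).
have sdG : self_dual rG.
  apply/self_dual_form; exists B => // x Gx.
  by apply: invB; apply: mem_quotient.
have ntG : ~~ (G \subset rker rG).
  apply: contra ntQ => /subsetP trivG; apply/subsetP=> y Qy; apply/rkerP; split=> //.
  by have /cosetP[x /trivG/rkerP[_ rx1] ->] := Qy.
have [Q [quadQ nzQ Qinv]] := quadG _ _ irrG sdG ntG.
exists Q; split=> // y v /cosetP[x Gx ->]; exact: Qinv.
Qed.

(** If [N] acts trivially the module factors through [G / N] with the same matrices; otherwise
    [normal_quadratic_type] applies to its symmetric invariant form. *)
Lemma extension_all_quadratic_type (F : fieldType) (gT : finGroupType)
    (G N : {group gT}) :
    (N <| G)%g -> 2%N \in [pchar F] ->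
    (forall H : {group gT}, H \subset G -> group_splitting_field F H) ->
    all_quadratic_type F N -> all_quadratic_type F (G / N)%G ->
  all_quadratic_type F G.
Proof.
move=> nsNG charF2 splitF quadN quadQ n rG irrG sdG ntG.
have [B unitB invB] := (self_dual_form rG).1 sdG.
have absG := splitF G (subxx G) _ _ irrG.
have [sNG nNG] := andP nsNG.
have [kN | ntN] := boolP (N \subset rker rG); last first.
  apply: (normal_quadratic_type nsNG irrG ntN invB _ quadN (splitF N sNG)).
    exact: inv_form_sym charF2 absG unitB invB.
  by apply: unitmx_neq0 unitB; case/andP: absG.
pose rQ := quo_repr kN nNG.
have irrQ : mx_irreducible rQ by apply/quo_mx_irr.
have sdQ : self_dual rQ.
  apply/self_dual_form; exists B => // y /morphimP[x Nx Gx ->].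
  by rewrite quo_repr_coset // invB.
have ntQ : ~~ ((G / N)%G \subset rker rQ).
  apply: contra ntG => /subsetP trivQ; apply/subsetP=> x Gx; apply/rkerP; split=> //.
  by have /rkerP[_] := trivQ _ (mem_quotient N Gx); rewrite quo_repr_coset.
have [Q [quadQf nzQ Qinv]] := quadQ _ _ irrQ sdQ ntQ.
exists Q; split=> // x v Gx.
by rewrite -(Qinv (coset N x) v) ?mem_quotient // quo_repr_coset.
Qed.

Theorem corollary16 (gT : finGroupType) (G N : {group gT}) (F : fieldType)
    (nsNG : (N <| G)%g)
    (charF2 : 2%N \in [pchar F]%R)
    (splitF : forall H : {group gT}, H \subset G -> group_splitting_field F H) :
  all_quadratic_type F G <->
  (all_quadratic_type F N /\ all_quadratic_type F (G / N)%G).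
Proof.
split=> [quadG | [quadN quadQ]].
  split; first exact: normal_all_quadratic_type nsNG charF2 splitF quadG.
  exact: quotient_all_quadratic_type nsNG quadG.
exact: extension_all_quadratic_type nsNG charF2 splitF quadN quadQ.
Qed.
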